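(* Let $A_2>0$ and let $\alpha(y,t)$, $\beta(y,t)$, $\gamma(y,t)$ be the functions determined from the solution $\hat N(y,t,\lambda)$ of the right RH problem (see context), so that they satisfy $$\alpha_t+\beta+\gamma=0,\qquad \beta_y-A_2(\alpha\beta-1)=0,\qquad \gamma_y+A_2(\alpha\gamma+1)=0.$$ Introduce $$\hat m=-\alpha^{-1},\qquad \hat u=\frac{\gamma-\beta}2,\qquad \hat v=\frac{\gamma+\beta}2$$ (at points where $\alpha\ne0$). Then these equations reduce to $$(\hat m^{-1})_t=2\hat v,\qquad \hat v=\hat u_y\frac{\hat m}{A_2},\qquad \hat m=\hat u-\hat v_y\frac{\hat m}{A_2}.$$
   Context: Let $0<A_1<A_2$; $\sigma_1=\begin{pmatrix}0&1\\1&0\end{pmatrix}$, $\sigma_3=\mathrm{diag}(1,-1)$; $\dot\Sigma_1=\{\lambda\in\mathbb{R}:|\lambda|>\frac1{A_1}\}$, $\dot\Sigma_0=\{\lambda\in\mathbb{R}:\frac1{A_2}<|\lambda|<\frac1{A_1}\}$, $\dot\Gamma_2=(-\frac1{A_2},\frac1{A_2})$; $l_2(\lambda)=\sqrt{\lambda^2-A_2^{-2}}$ with cut $[-\frac1{A_2},\frac1{A_2}]$ and $l_2(\lambda)\sim\lambda$ at infinity; $\hat f_2(y,t,\lambda)=\frac{\mathrm{i}A_2l_2(\lambda)}2(y-\frac{2t}{\lambda^2})$. Data: a function $r$ on $\dot\Sigma_1\cup\dot\Sigma_0$ with $r(\lambda)=-\overline{r(-\lambda)}$ on $\dot\Sigma_1$,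 and $r(\lambda)=-1/r(-\lambda)$, $|r(\lambda)|=1$ on $\dot\Sigma_0$ (not a priori associated with initial data). Right RH problem: find $\hat N(y,t,\lambda)$ ($2\times2$, analytic in $\lambda\in\mathbb{C}\setminus\mathbb{R}$) with $\hat N_+=\hat N_-\hat G$ on $\mathbb{R}\setminus\{\pm\frac1{A_1},\pm\frac1{A_2}\}$ (boundary values from $\mathbb{C}_\pm$), where $\hat G=e^{-\hat f_2\sigma_3}\begin{pmatrix}1-|r|^2&-\bar r\\ r&1\end{pmatrix}e^{\hat f_2\sigma_3}$ on $\dot\Sigma_1$, $\hat G=e^{-\hat f_2\sigma_3}\begin{pmatrix}0&-1/r\\ r&1\end{pmatrix}e^{\hat f_2\sigma_3}$ on $\dot\Sigma_0$, $\hat G=-\mathrm{i}\sigma_1$ on $\dot\Gamma_2$; singularities at $\pm\frac1{A_j}$ of order at most $\frac14$; $\hat N=I+O(1/\lambda)$ as $\lambda\to\infty$. Standing assumption: the solution exists (it is then unique) and is differentiable with respect to $y$ and $t$. Real-valued functions $\hat a_1,\hat a_2,\hat a_3$ of $(y,t)$ are defined by $\hat N=-\sqrt{\frac12}\left(\mathrm{i}\begin{pmatrix}\mathrm{i}\hat a_1^{-1}&\hat a_1\\\hat a_1^{-1}&\mathrm{i}\hat a_1\end{pmatrix}+\mathrm{i}\lambda\begin{pmatrix}\hat a_2&\mathrm{i}\hat a_3\\\mathrm{i}\hat a_2&\hat a_3\end{pmatrix}\right)+O(\lambda^2)$ as $\lambda\to0$, $\lambda\in\mathbb{C}_+$. Put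 $\hat n=\sqrt{\frac12}\begin{pmatrix}-1&\mathrm{i}\\\mathrm{i}&-1\end{pmatrix}\hat N$, with expansion $\hat n=\sqrt{\frac12}\begin{pmatrix}-1&\mathrm{i}\\\mathrm{i}&-1\end{pmatrix}+\frac1\lambda(\hat n_{ij}(y,t))+O(\lambda^{-2})$ as $\lambda\to\infty$. Then $\alpha=\sqrt2(\hat n_{12}+\hat n_{21})$, $\beta=-2\hat a_1\hat a_2$, $\gamma=2\hat a_3\hat a_1^{-1}$. *)

(* Defs.v *)
From Stdlib Require Import Reals.
From Coquelicot Require Import Coquelicot.
Open Scope C_scope.

Notation mat2 := (@matrix C 2 2).

(* [coeff_mat] returns the default [0] when an index is out of range, so
   quantifying over all [i j : nat] below only constrains the four entries. *)
Definition entry (M : mat2) (i j : nat) : C := coeff_mat (RtoC 0) M i j.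

Definition Mscal (c : C) (M : mat2) : mat2 :=
  mk_matrix 2 2 (fun i j => c * entry M i j).

Definition Msub (M P : mat2) : mat2 :=
  mk_matrix 2 2 (fun i j => entry M i j - entry P i j).

Definition Mid : mat2 := [[RtoC 1, RtoC 0], [RtoC 0, RtoC 1]].
Definition sigma1 : mat2 := [[RtoC 0, RtoC 1], [RtoC 1, RtoC 0]].

Definition Cexp (z : C) : C :=
  ((exp (Re z) * cos (Im z))%R, (exp (Re z) * sin (Im z))%R).

(* Principal square root, with cut along the nonpositive real axis. *)
Definition Csqrt (z : C) : C :=
  (sqrt ((Cmod z + Re z) / 2),
   ((if Rlt_dec (Im z) 0 then -1 else 1) * sqrt ((Cmod z - Re z) / 2))%R).

Definition exp_sigma3 (z : C) : mat2 :=
  [[Cexp z, RtoC 0], [RtoC 0, Cexp (- z)]].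

Definition Sigma1 (A1 : R) (l : R) : Prop := (1 / A1 < Rabs l)%R.
Definition Sigma0 (A1 A2 : R) (l : R) : Prop :=
  (1 / A2 < Rabs l /\ Rabs l < 1 / A1)%R.
Definition Gamma2 (A2 : R) (l : R) : Prop := (- (1 / A2) < l < 1 / A2)%R.

(* The branch of sqrt (l^2 - A2^-2) with cut [-1/A2, 1/A2] and l2 ~ l at
   infinity: 1 - (A2 l)^-2 is a nonpositive real exactly when
   0 < (A2 l)^2 <= 1. *)
Definition l2 (A2 : R) (l : C) : C :=
  l * Csqrt (1 - / ((RtoC A2 * l) * (RtoC A2 * l))).

Definition f2 (A2 y t : R) (l : C) : C :=
  Ci * RtoC A2 * l2 A2 l / 2 * (RtoC y - 2 * RtoC t / (l * l)).

Definition reflection_data (A1 A2 : R) (r : R -> C) : Prop :=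
  (forall l, Sigma1 A1 l -> r l = - Cconj (r (- l)%R)) /\
  (forall l, Sigma0 A1 A2 l -> r l = - (1 / r (- l)%R) /\ Cmod (r l) = 1%R).

Definition dress (A2 y t l : R) (J : mat2) : mat2 :=
  Mmult (Mmult (exp_sigma3 (- f2 A2 y t (RtoC l))) J)
        (exp_sigma3 (f2 A2 y t (RtoC l))).

Definition jump_Sigma1 (A2 : R) (r : R -> C) (y t l : R) : mat2 :=
  dress A2 y t l [[RtoC (1 - Cmod (r l) ^ 2)%R, - Cconj (r l)],
                  [r l, RtoC 1]].
Definition jump_Sigma0 (A2 : R) (r : R -> C) (y t l : R) : mat2 :=
  dress A2 y t l [[RtoC 0, - (1 / r l)], [r l, RtoC 1]].
Definition jump_Gamma2 : mat2 := Mscal (- Ci) sigma1.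

Definition upper_at (z0 : C) : (C -> Prop) -> Prop :=
  within (fun z => (0 < Im z)%R) (locally z0).
Definition lower_at (z0 : C) : (C -> Prop) -> Prop :=
  within (fun z => (Im z < 0)%R) (locally z0).
Definition offR_at (z0 : C) : (C -> Prop) -> Prop :=
  within (fun z => Im z <> 0%R) (locally z0).
Definition offR_infty (P : C -> Prop) : Prop :=
  exists B : R, forall z, Im z <> 0%R -> (B < Cmod z)%R -> P z.

Definition is_Mlim (F : (C -> Prop) -> Prop) (M : C -> mat2) (L : mat2) : Prop :=
  forall i j, filterlim (fun z => entry (M z) i j) F (locally (entry L i j)).

Definition is_MbigO (F : (C -> Prop) -> Prop) (M : C -> mat2) (g : C -> R) : Prop :=
  exists K : R, F (fun z => forall i j, (Cmod (entry (M z) i j) <= K * g z)%R).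

Definition has_jump (M : C -> mat2) (l : R) (G : mat2) : Prop :=
  exists Mp Mm : mat2,
    is_Mlim (upper_at (RtoC l)) M Mp /\
    is_Mlim (lower_at (RtoC l)) M Mm /\
    Mp = Mmult Mm G.

Record right_RH (A1 A2 : R) (r : R -> C) (y t : R) (M : C -> mat2) : Prop := {
  RH_analytic : forall z, Im z <> 0%R ->
    forall i j, ex_derive (K := C_AbsRing) (V := C_NormedModule)
                  (fun w => entry (M w) i j) z;
  RH_jump_Sigma1 : forall l, Sigma1 A1 l ->
    has_jump M l (jump_Sigma1 A2 r y t l);
  RH_jump_Sigma0 : forall l, Sigma0 A1 A2 l ->
    has_jump M l (jump_Sigma0 A2 r y t l);
  RH_jump_Gamma2 : forall l, Gamma2 A2 l -> has_jump M l jump_Gamma2;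
  RH_singularities : forall p : R,
    (p = 1 / A1 \/ p = - (1 / A1) \/ p = 1 / A2 \/ p = - (1 / A2))%R ->
    is_MbigO (offR_at (RtoC p)) M
      (fun z => Rpower (Cmod (z - RtoC p)) (- (1 / 4)));
  RH_normalization :
    is_MbigO offR_infty (fun z => Msub (M z) Mid) (fun z => (/ Cmod z)%R)
}.

Definition differentiable_yt (N : R -> R -> C -> mat2) : Prop :=
  forall (y t : R) (z : C), Im z <> 0%R -> forall i j,
    ex_derive (K := R_AbsRing) (V := C_R_NormedModule)
      (fun y' => entry (N y' t z) i j) y /\
    ex_derive (K := R_AbsRing) (V := C_R_NormedModule)
      (fun t' => entry (N y t' z) i j) t.

Definition expansion_0 (N : R -> R -> C -> mat2) (a1 a2 a3 : R -> R -> R) : Prop :=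
  forall y t : R,
    let b1 := RtoC (a1 y t) in
    let b2 := RtoC (a2 y t) in
    let b3 := RtoC (a3 y t) in
    a1 y t <> 0%R /\
    is_MbigO (upper_at (RtoC 0))
      (fun z => Msub (N y t z)
         (Mscal (- RtoC (sqrt (1 / 2)))
            (Mplus (Mscal Ci [[Ci * / b1, b1], [/ b1, Ci * b1]])
                   (Mscal (Ci * z) [[b2, Ci * b3], [Ci * b2, b3]]))))
      (fun z => (Cmod z ^ 2)%R).

Definition n_prefactor : mat2 :=
  Mscal (RtoC (sqrt (1 / 2))) [[RtoC (-1), Ci], [Ci, RtoC (-1)]].

Definition n_of (N : R -> R -> C -> mat2) (y t : R) (z : C) : mat2 :=
  Mmult n_prefactor (N y t z).

Definition expansion_infty (n : R -> R -> C -> mat2) (n1 : R -> R -> mat2) : Prop :=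
  forall y t : R,
    is_MbigO offR_infty
      (fun z => Msub (n y t z) (Mplus n_prefactor (Mscal (/ z) (n1 y t))))
      (fun z => (/ (Cmod z ^ 2))%R).

(* [entry] counts from 0, so n_12 + n_21 is [entry _ 0 1 + entry _ 1 0]. *)
Definition alpha_of (n1 : R -> R -> mat2) (y t : R) : C :=
  RtoC (sqrt 2) * (entry (n1 y t) 0 1 + entry (n1 y t) 1 0).
Definition beta_of (a1 a2 : R -> R -> R) (y t : R) : R :=
  (-2 * a1 y t * a2 y t)%R.
Definition gamma_of (a1 a3 : R -> R -> R) (y t : R) : R :=
  (2 * a3 y t * / a1 y t)%R.

(* The existence of the derivatives occurring in the equations is part of
   satisfying them. *)
Definition alpha_beta_gamma_system (A2 : R) (alpha : R -> R -> C)
    (beta gamma : R -> R -> R) (y t : R) : Prop :=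
  exists (alpha_t : C) (beta_y gamma_y : R),
    is_derive (K := R_AbsRing) (V := C_R_NormedModule)
      (fun t' => alpha y t') t alpha_t /\
    is_derive (fun y' => beta y' t) y beta_y /\
    is_derive (fun y' => gamma y' t) y gamma_y /\
    alpha_t + RtoC (beta y t) + RtoC (gamma y t) = 0 /\
    RtoC beta_y - RtoC A2 * (alpha y t * RtoC (beta y t) - 1) = 0 /\
    RtoC gamma_y + RtoC A2 * (alpha y t * RtoC (gamma y t) + 1) = 0.

Definition m_of (alpha : R -> R -> C) (y t : R) : C := - / alpha y t.
Definition u_of (beta gamma : R -> R -> R) (y t : R) : R :=
  ((gamma y t - beta y t) / 2)%R.
Definition v_of (beta gamma : R -> R -> R) (y t : R) : R :=
  ((gamma y t + beta y t) / 2)%R.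

Definition m_u_v_system (A2 : R) (m : R -> R -> C) (u v : R -> R -> R)
    (y t : R) : Prop :=
  exists (minv_t : C) (u_y v_y : R),
    is_derive (K := R_AbsRing) (V := C_R_NormedModule)
      (fun t' => / m y t') t minv_t /\
    is_derive (fun y' => u y' t) y u_y /\
    is_derive (fun y' => v y' t) y v_y /\
    minv_t = 2 * RtoC (v y t) /\
    RtoC (v y t) = RtoC u_y * (m y t / RtoC A2) /\
    m y t = RtoC (u y t) - RtoC v_y * (m y t / RtoC A2).

(* Main.v *)
Require Import Defs.
From Stdlib Require Import Reals.
From Coquelicot Require Import Coquelicot.
Open Scope C_scope.

(** The new equations are the old ones rewritten pointwise in the variables
    [m], [u], [v].  As [1/m = - alpha], the equation for [alpha_t] says
    [(1/m)_t = - alpha_t = beta + gamma = 2 v].  Half the difference and half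
    the sum of the equations for [gamma_y] and [beta_y] are
    [u_y = - A2 alpha v] and [v_y = - A2 (alpha u + 1)];
    multiplying these by [m / A2 = - 1 / (A2 alpha)] gives
    [u_y m / A2 = v] and [v_y m / A2 = u + 1 / alpha = u - m]. *)

(** The zeros of [alpha] are included, the inverse of [0] being [0], so that
    [/ m] and [- alpha] agree as functions of [t] and have the same
    [t]-derivative. *)
Lemma inv_m_of (alpha : R -> R -> C) (y t : R) :
  / m_of alpha y t = - alpha y t.
Proof.
  unfold m_of.
  destruct (Ceq_dec (alpha y t) 0) as [-> | Hne].
  - unfold Cinv, Copp, RtoC; simpl; apply injective_projections; simpl;
      unfold Rdiv; ring.
  - field; exact Hne.
Qed.

Lemma m_u_v_system_of_alpha_beta_gamma_system
    (A2 : R) (alpha : R -> R -> C) (beta gamma : R -> R -> R) (y t : R) :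
  A2 <> 0%R -> alpha y t <> 0 ->
  alpha_beta_gamma_system A2 alpha beta gamma y t ->
  m_u_v_system A2 (m_of alpha) (u_of beta gamma) (v_of beta gamma) y t.
Proof.
  intros HA2 Halpha (alpha_t & beta_y & gamma_y & Dalpha & Dbeta & Dgamma
                     & Et & Ebeta & Egamma).
  assert (HA2C : RtoC A2 <> 0) by (intros H; apply HA2, RtoC_inj, H).
  assert (Hbeta : RtoC beta_y = RtoC A2 * (alpha y t * RtoC (beta y t) - 1)).
  { rewrite <- (Cplus_0_r (RtoC A2 * _)), <- Ebeta; ring. }
  assert (Hgamma : RtoC gamma_y = - (RtoC A2 * (alpha y t * RtoC (gamma y t) + 1))).
  { rewrite <- (Cplus_0_r (- _)), <- Egamma; ring. }
  exists (- alpha_t), ((gamma_y - beta_y) / 2)%R, ((gamma_y + beta_y) / 2)%R.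
  assert (H2 : (2 <> 0)%R) by apply Rgt_not_eq, Rlt_0_2.
  assert (H2C : RtoC 2 <> 0) by (intros H; apply H2, RtoC_inj, H).
  unfold u_of, v_of.
  assert (Derive_beta : Derive (fun y' : R => beta y' t) y = beta_y)
    by exact (is_derive_unique _ _ _ Dbeta).
  assert (Derive_gamma : Derive (fun y' : R => gamma y' t) y = gamma_y)
    by exact (is_derive_unique _ _ _ Dgamma).
  split; [ | split; [ | split; [ | split; [ | split ]]]].
  - apply (is_derive_ext (fun t' => opp (alpha y t'))).
    { intros t'; symmetry; apply inv_m_of. }
    apply (is_derive_opp (K := R_AbsRing) (V := C_R_NormedModule)), Dalpha.
  - auto_derive.
    + repeat split; [exists gamma_y | exists beta_y]; assumption.
    + rewrite Derive_beta, Derive_gamma; field.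
  - auto_derive.
    + repeat split; [exists gamma_y | exists beta_y]; assumption.
    + rewrite Derive_beta, Derive_gamma; field.
  - rewrite RtoC_div, RtoC_plus by exact H2.
    rewrite <- (Cplus_0_r (- alpha_t)), <- Et; field; exact H2C.
  - unfold m_of; rewrite !RtoC_div, RtoC_plus, RtoC_minus, Hbeta, Hgamma
      by exact H2.
    field; auto.
  - unfold m_of; rewrite !RtoC_div, RtoC_plus, RtoC_minus, Hbeta, Hgamma
      by exact H2.
    field; auto.
Qed.

Theorem corollary3p7 :
  forall (A1 A2 : R) (r : R -> C) (N : R -> R -> C -> mat2)
         (a1 a2 a3 : R -> R -> R) (n1 : R -> R -> mat2),
    (0 < A1 < A2)%R ->
    reflection_data A1 A2 r ->
    (forall y t : R, right_RH A1 A2 r y t (N y t)) ->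
    differentiable_yt N ->
    expansion_0 N a1 a2 a3 ->
    expansion_infty (n_of N) n1 ->
    let alpha := alpha_of n1 in
    let beta := beta_of a1 a2 in
    let gamma := gamma_of a1 a3 in
    (forall y t : R, alpha_beta_gamma_system A2 alpha beta gamma y t) ->
    let m := m_of alpha in
    let u := u_of beta gamma in
    let v := v_of beta gamma in
    forall y t : R, alpha y t <> 0 -> m_u_v_system A2 m u v y t.
Proof.
  intros A1 A2 r N a1 a2 a3 n1 [HA1 HA12] _ _ _ _ _ alpha beta gamma Hsys
    m u v y t Halpha.
  apply m_u_v_system_of_alpha_beta_gamma_system; [ | exact Halpha | apply Hsys].
  apply Rgt_not_eq, (Rlt_trans _ _ _ HA1 HA12).
Qed.
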